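(* Let $K$ be an algebraic number field of possibly infinite degree (an algebraic extension of $\mathbb{Q}$) which is Galois over $\mathbb{Q}$. Then the group ${\sf Gal}\big({\sf N}_\bullet[K]/K\big)$ of nonlinear automorphisms of ${\sf N}_\bullet[K]$ fixing $K$ is trivial: $${\sf Gal}\big({\sf N}_\bullet[K]/K\big)\cong\{1\}.$$
   Context: **Hilbert space.** For a finite extension $K/\mathbb{Q}$ let $\mathbb{S}_K=\mathbb{A}_K/(K,+)$ be the adele class group; for $K/\mathbb{Q}$ infinite algebraic, let $\mathbb{S}_K$ denote here the inverse limit of the groups $\mathbb{A}_{K'}/(K',+)$ over finite subextensions $K'\subset K$ along the maps induced by the field traces. It is a compact abelian group with unit mass Haar measure, and its characters $\phi_\alpha$ are canonically indexed by $\alpha\in K$ with $\phi_{\alpha}\phi_{\beta}=\phi_{\alpha+\beta}$. Every $f\in L^2(\mathbb{S}_K,\mathbb{C})$ is $f=\sum_{\alpha\in K}a_\alpha\phi_\alpha$ with $(a_\alpha)\in\ell^2(K)$. The Hilbert space ${\sf H}_\bullet[K]$ of graded-holomorphic functions is identified isometrically, by taking boundary values, with $L^2(\mathbb{S}_K,\mathbb{C})\cong \ell^2(K)$; its elements are written $F=\sum_{\alpha\in K}a_\alpha\boldsymbol\varrho^\alpha$, where the monomial $\boldsymbol\varrho^\alpha$ has boundary value $\phi_\alpha$, and $\|F\|^2=\sum|a_\alpha|^2$. **Grading.** A field $K$ Galois over $\mathbb{Q}$ is totally real or totally complex. If it is totally real, the sign of $\alpha\in K\setminus\{0\}$ is the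 vector of signs $\pm$ of its images under the real places. If it is totally complex, choose one embedding $\mu$ from each complex conjugate pair of embeddings; the sign of $\alpha\ne0$ is the vector, indexed by the chosen $\mu$, recording which of the following eight pieces of $\mathbb{C}\setminus\{0\}$ contains $\mu(\alpha)$: the four open half-axes $\mathbb{R}_+, i\mathbb{R}_+,-\mathbb{R}_+,-i\mathbb{R}_+$ or the four open quadrants. Let $\mho_K$ be the set of sign vectors (in the complex case, those realized by elements of $K$), $K^{\boldsymbol\vartheta}$ the set of $\alpha\in K\setminus\{0\}$ of sign $\boldsymbol\vartheta$, and ${\sf H}_{\boldsymbol\vartheta}[K]\subset{\sf H}_\bullet[K]$ the closed subspace of series supported on $K^{\boldsymbol\vartheta}$. Then ${\sf H}_\bullet[K]=\big(\bigoplus_{\boldsymbol\vartheta\in\mho_K}{\sf H}_{\boldsymbol\vartheta}[K]\big)\oplus\mathbb{C}$, the last summand being the constants $\mathbb{C}\boldsymbol\varrho^0$. **Products.** For $F=\sum a_\alpha\boldsymbol\varrho^\alpha$, $G=\sum b_\alpha\boldsymbol\varrho^\alpha$: the Cauchy product is $F\oplus G=\sum_\alpha\big(\sum_{\alpha_1+\alpha_2=\alpha}a_{\alpha_1}b_{\alpha_2}\big)\boldsymbol\varrho^\alpha$, defined when the coefficient sequence lies in $\ell^2(K)$. The Dirichlet product is $F\otimes G=\sum_\alpha d_\alpha\boldsymbol\varrho^\alpha$, $d_\alpha=\sum_{\alpha_1\alpha_2=\alpha}a_{\alpha_1}b_{\alpha_2}$, defined when the expression $d_0=a_0\sum_{\alpha\neq0}b_\alpha+b_0\sum_{\alpha\ne0}a_\alpha+a_0b_0$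 converges absolutely and $(d_\alpha)\in\ell^2(K)$. **Nonlinear field.** Let ${\sf I}_K\subset{\sf H}_\bullet[K]$ be the set of $F$ with $(a_\alpha)$ absolutely summable and $\sum a_\alpha=0$. Set ${\sf N}_\bullet[K]=({\sf H}_\bullet[K]\setminus{\sf I}_K)/\mathbb{C}^*$, a subset of the full projectivization $\bar{\sf N}_\bullet[K]=\mathbb{P}{\sf H}_\bullet[K]$. It inherits $\oplus$ and $\otimes$ as partially defined operations (on classes $[F]$). The field $K$ is embedded in ${\sf N}_\bullet[K]$ by $\alpha\mapsto[\boldsymbol\varrho^\alpha]$. **Automorphisms.** $\bar{\sf N}_\bullet[K]$ carries the Fubini–Study metric of the inner product. A *nonlinear automorphism* $\Upsilon:{\sf N}_\bullet[K]\to{\sf N}_\bullet[K]$ is the restriction of a bijective Fubini–Study isometry of $\bar{\sf N}_\bullet[K]$ which is graded, i.e. for some permutation $\iota$ of $\mho_K$ one has $\Upsilon(\mathbb{P}{\sf H}_{\boldsymbol\vartheta}[K])=\mathbb{P}{\sf H}_{\iota(\boldsymbol\vartheta)}[K]$ for all $\boldsymbol\vartheta$, and such that $\Upsilon([F]\oplus[G])=\Upsilon([F])\oplus\Upsilon([G])$ and $\Upsilon([F]\otimes[G])=\Upsilon([F])\otimes\Upsilon([G])$ whenever the operations are defined. ${\sf Gal}({\sf N}_\bullet[K]/K)$ is the group of nonlinear automorphisms fixing every $[\boldsymbol\varrho^\alpha]$, $\alpha\in K$.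
   Formalization: Fubini–Study isometries are required to be holomorphic as well as distance-preserving; otherwise complex conjugation of the coefficients, [Σ a_α ρ^α] ↦ [Σ conj(a_α) ρ^α], is a nontrivial nonlinear automorphism fixing K. *)

(* Defs.v *)
From HB Require Import structures.
From mathcomp Require Import all_boot all_order all_algebra.
From mathcomp Require Import all_classical all_reals all_analysis.
From mathcomp Require Import separable complex.

Set Implicit Arguments.
Unset Strict Implicit.
Unset Printing Implicit Defensive.

Import Order.TTheory GRing.Theory Num.Theory.
Import numFieldNormedType.Exports.

Local Open Scope classical_set_scope.
Local Open Scope ring_scope.

Notation modc := (@complex.ComplexField.Normc.normc _).

Definition algebraic_ext (K : fieldType) (iota : {rmorphism rat -> K}) : Prop :=
  forall x : K, algebraicOver iota x.

Definition normal_ext (K : fieldType) (iota : {rmorphism rat -> K}) : Prop :=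
  forall p : {poly rat}, irreducible_poly p ->
    (exists x : K, root (map_poly iota p) x) ->
    exists s : seq K, map_poly iota p %= \prod_(a <- s) ('X - a%:P).

Definition separable_ext (K : fieldType) (iota : {rmorphism rat -> K}) : Prop :=
  forall x : K, exists2 p : {poly rat},
    separable_poly p & root (map_poly iota p) x.

Definition galois_over_Q (K : fieldType) (iota : {rmorphism rat -> K}) : Prop :=
  [/\ algebraic_ext iota, normal_ext iota & separable_ext iota].

Section Sums.
Context {R : realType} {T : choiceType}.

Definition csummable (D : set T) (f : T -> R[i]) : Prop :=
  summable D (fun x => (modc (f x))%:E).

(* The sum of an absolutely convergent family; the value is irrelevant when
   [csummable D f] fails. *)
Definition rsum (D : set T) (u : T -> R) : R :=
  fine (esum D (EFin \o u)^\+ - esum D (EFin \o u)^\-)%E.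

Definition csum (D : set T) (f : T -> R[i]) : R[i] :=
  Complex (rsum D (fun x => complex.Re (f x)))
          (rsum D (fun x => complex.Im (f x))).

End Sums.

Section Hilbert.
Context (R : realType) (K : fieldType).

(* The coefficient family (a_alpha) stands for the sum of the
   a_alpha rho^alpha. *)
Definition coefs : Type := K -> R[i].

Definition ell2 : set coefs :=
  [set F | (\esum_(x in setT) (modc (F x) ^+ 2)%:E < +oo)%E].

Definition inner (F G : coefs) : R[i] := csum setT (fun x => F x * conjc (G x)).

Definition hnorm (F : coefs) : R :=
  Num.sqrt (fine (\esum_(x in setT) (modc (F x) ^+ 2)%:E)).

Definition monomial (alpha : K) : coefs := fun x => (x == alpha)%:R.

Definition null_sum : set coefs :=
  [set F | csummable setT F /\ csum setT F = 0].

Definition line (F : coefs) : set coefs := [set c *: F | c in [set c | c != 0]].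

Definition PH_lines : set (set coefs) := [set line F | F in ell2 `\ (0 : coefs)].

Definition PH : Type := set_type PH_lines.

Definition vecs (P : PH) : set coefs := \val P.

Definition PN_points : set PH := [set P | forall F, vecs P F -> ~ null_sum F].

Definition PN : Type := set_type PN_points.

Definition PN_PH (P : PN) : PH := \val P.

(* [op] is the addition of K for the Cauchy product, its multiplication for the
   Dirichlet product. *)
Definition fibre (op : K -> K -> K) (alpha : K) : set (K * K) :=
  [set p | op p.1 p.2 = alpha].

Definition convolution (op : K -> K -> K) (F G : coefs) : coefs :=
  fun alpha => csum (fibre op alpha) (fun p => F p.1 * G p.2).

(* The first clause is a genuine restriction only for the Dirichlet product at
   alpha = 0, where it says that
     a_0 sum_{alpha <> 0} b_alpha + b_0 sum_{alpha <> 0} a_alpha + a_0 b_0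
   converges absolutely; otherwise it holds by Cauchy-Schwarz. *)
Definition convolvable (op : K -> K -> K) (F G : coefs) : Prop :=
  (forall alpha, csummable (fibre op alpha) (fun p => F p.1 * G p.2)) /\
  ell2 (convolution op F G).

(* [PN_mul op P Q S]: the partial operation induced by [op] is defined at
   (P, Q), with value S. *)
Definition PN_mul (op : K -> K -> K) (P Q S : PN) : Prop :=
  exists F G, [/\ vecs (PN_PH P) F, vecs (PN_PH Q) G, convolvable op F G &
                  vecs (PN_PH S) (convolution op F G)].

Definition rep (P : PH) : coefs := xget 0 (vecs P).

Definition fs_dist (P Q : PH) : R :=
  acos (modc (inner (rep P) (rep Q)) / (hnorm (rep P) * hnorm (rep Q))).

(* Complex differentiability at every point along every complex line, by means
   of local lifts Phi of z |-> V [F + z G]. *)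
Definition holomorphic (V : PH -> PH) : Prop :=
  forall F G : coefs, ell2 F -> F <> 0 -> ell2 G ->
  exists (Phi : R[i]^o -> coefs) (D : coefs),
    [/\ ell2 D,
        \forall z \near (0 : R[i]^o),
          forall P : PH, vecs P (F + z *: G) -> vecs (V P) (Phi z) &
        hnorm (z^-1 *: (Phi z - Phi 0) - D)
          @[z --> (0 : R[i]^o)^'] --> (0 : R)].

(* The Fubini-Study metric is regarded as a Hermitian (Kaehler) metric, so that
   its isometries preserve the complex structure along with the distance.
   Preservation of the distance alone would also admit the maps induced by
   antiunitary operators, in particular
     [sum a_alpha rho^alpha] |-> [sum (conjc a_alpha) rho^alpha],
   which fixes every [rho^alpha], respects the grading and commutes with both
   products. *)
Definition fs_isometry (V : PH -> PH) : Prop :=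
  [/\ bijective V,
      forall P Q, fs_dist (V P) (V Q) = fs_dist P Q &
      holomorphic V].

(* One embedding from each pair of conjugate embeddings; a real embedding is
   its own conjugate, so for K totally real these are all the real places. *)
Definition conj_representatives (M : set {rmorphism K -> R[i]}) : Prop :=
  forall s : {rmorphism K -> R[i]},
    exists! m : {rmorphism K -> R[i]}, M m /\ (m =1 s \/ m =1 conjc \o s).

Definition totally_real : Prop :=
  forall (s : {rmorphism K -> R[i]}) (x : K), complex.Im (s x) = 0.

Section Grading.
Variable M : set {rmorphism K -> R[i]}.

(* The level sets of (sgz Re, sgz Im) on the nonzero complex numbers are the
   four open half-axes and the four open quadrants; on nonzero reals this is
   (1, 0) or (-1, 0), i.e. the usual sign. *)
Definition sign_vector (alpha : K) : set_type M -> int * int :=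
  fun m => (sgz (complex.Re (\val m alpha)), sgz (complex.Im (\val m alpha))).

Definition realized_signs : set (set_type M -> int * int) :=
  [set sign_vector alpha | alpha in [set alpha | alpha != 0]].

Definition real_signs : set (set_type M -> int * int) :=
  [set theta | totally_real /\ forall m, theta m = (1, 0) \/ theta m = (-1, 0)].

Definition mho : set (set_type M -> int * int) := real_signs `|` realized_signs.

Definition K_sign (theta : set_type M -> int * int) : set K :=
  [set alpha | alpha != 0 /\ sign_vector alpha = theta].

Definition H_sign (theta : set_type M -> int * int) : set coefs :=
  [set F | ell2 F /\ forall alpha, F alpha != 0 -> K_sign theta alpha].

Definition PH_sign (theta : set_type M -> int * int) : set PH :=
  [set P | vecs P `<=` H_sign theta].

Definition graded (V : PH -> PH) : Prop :=
  exists iota : set_type mho -> set_type mho, bijective iota /\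
    forall theta, V @` PH_sign (\val theta) = PH_sign (\val (iota theta)).

Definition compatible (op : K -> K -> K) (U : PN -> PN) : Prop :=
  forall P Q S S' : PN, PN_mul op P Q S -> PN_mul op (U P) (U Q) S' -> U S = S'.

Definition nonlinear_automorphism (U : PN -> PN) : Prop :=
  (exists V : PH -> PH,
     [/\ fs_isometry V, graded V & forall P, PN_PH (U P) = V (PN_PH P)]) /\
  compatible +%R U /\ compatible *%R U.

End Grading.

Lemma esum_monomial (alpha : K) (g : K -> \bar R) :
  (forall x, 0 <= g x)%E -> (forall x, x != alpha -> g x = 0)%E ->
  \esum_(x in setT) g x = g alpha.
Proof.
move=> g0 g1; rewrite (esumID [set alpha]) ?setTI; last by move=> *; exact: g0.
rewrite esum_set1// [X in (_ + X)%E]esum1 ?adde0// => x /= /eqP xa.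
exact: g1.
Qed.

Lemma rsum_monomial (alpha : K) (u : K -> R) :
  (forall x, x != alpha -> u x = 0) -> rsum setT u = u alpha.
Proof.
move=> u0; rewrite /rsum.
rewrite [X in (X - _)%E](@esum_monomial alpha); first last.
- by move=> x /u0 ux; rewrite funeposE /= ux maxxx.
- by move=> x; exact: funepos_ge0.
rewrite [X in (_ - X)%E](@esum_monomial alpha); first last.
- by move=> x /u0 ux; rewrite funenegE /= ux oppr0 maxxx.
- by move=> x; exact: funeneg_ge0.
by rewrite -[X in fine X]/((((EFin \o u)^\+) \- ((EFin \o u)^\-))%E alpha)
  -funeposneg.
Qed.

Lemma csum_monomial (alpha : K) (c : R[i]) :
  csum setT (c *: monomial alpha) = c.
Proof.
have E : forall x, (c *: monomial alpha) x = c * (x == alpha)%:R by [].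
have E0 x : x != alpha -> (c *: monomial alpha) x = 0.
  by move=> xa; rewrite E (negbTE xa) mulr0.
rewrite /csum (@rsum_monomial alpha); last by move=> x /E0 ->.
rewrite (@rsum_monomial alpha); last by move=> x /E0 ->.
by rewrite E eqxx mulr1; case: c {E E0}.
Qed.

Lemma monomial_PH (alpha : K) :
  PH_lines (line (monomial alpha)).
Proof.
exists (monomial alpha) => //; split; last first.
  move=> /(congr1 (fun F : coefs => F alpha)) /eqP.
  by rewrite /monomial eqxx oner_eq0.
rewrite /ell2 /= (@esum_monomial alpha) ?ltry// => x.
- by rewrite lee_fin sqr_ge0.
- by move=> xa; rewrite /monomial (negbTE xa) Normc.normc0 expr0n.
Qed.

Definition mono_PH (alpha : K) : PH := exist (fun P => P \in PH_lines) _ (mem_set (monomial_PH alpha)).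

Lemma monomial_PN (alpha : K) :
  PN_points (mono_PH alpha).
Proof.
move=> _ [c /= c0 <-] [_]; rewrite csum_monomial => c_eq0.
by rewrite c_eq0 eqxx in c0.
Qed.

(* The embedding alpha |-> [rho^alpha] of K. *)
Definition mono_PN (alpha : K) : PN := exist (fun P => P \in PN_points) _ (mem_set (@monomial_PN alpha)).

(* Gal(N[K]/K), as a set of self-maps of N[K]; the group law is composition. *)
Definition nonlinear_Gal (M : set {rmorphism K -> R[i]}) : set (PN -> PN) :=
  [set U | nonlinear_automorphism M U /\
           forall alpha, U (mono_PN alpha) = mono_PN alpha].

End Hilbert.

(* Main.v *)
Require Import Defs.
From mathcomp Require Import all_boot all_order all_algebra.
From mathcomp Require Import all_classical all_reals all_analysis.
From mathcomp Require Import complex ring lra.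

(** An automorphism fixing every [rho^alpha] comes from a holomorphic isometry
    V of the projective space P(ell2 K) that fixes every coordinate line, so V
    preserves the normalised moduli |F_alpha| / |F| of all coordinates.  The
    idea is that V then fixes enough lines supported on two coordinates for the
    polarization identity to pin down every other line.

    - V fixes [rho^alpha - rho^beta] ([isometry_fix_minus]).  The preimage of
      this line is spanned by some rho^alpha + x rho^beta with |x| = 1.  The
      automorphism maps N[K] to itself, that is, V never sends a line outside
      the locus of absolutely summable families of sum zero into that locus.
      Since rho^alpha - rho^beta has sum zero, 1 + x = 0.
    - Hence V sends [rho^alpha + z rho^beta] to itself or to
      [rho^alpha + conj(z) rho^beta] ([isometry_pair_conj]).  If the second
      alternative occurred for z = i, it would occur for every z
      ([isometry_conj]); holomorphy of V at [rho^alpha] in the direction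
      rho^beta would then make z |-> p(z) conj(z) differentiable at 0 for some p
      that is differentiable and nonzero there, which is absurd
      ([antiholomorphic_no_derivative]).  So V fixes [rho^alpha + i rho^beta]
      ([isometry_fix_i]).
    - If F spans a line and G its image, then the distances to the lines of
      rho^alpha, rho^alpha - rho^beta and rho^alpha + i rho^beta give
      F_beta conj(F_alpha) / |F|^2 = G_beta conj(G_alpha) / |G|^2 for all alpha
      and beta ([polarization]).  Choosing alpha with F_alpha <> 0 shows that G
      is proportional to F ([isometry_fix]).

    Conversely the identity is an automorphism because both partial products
    are single-valued on lines ([PN_mul_functional]): rescaling the factors
    rescales each absolutely convergent coefficient sum. *)

Set Implicit Arguments.
Unset Strict Implicit.
Unset Printing Implicit Defensive.

Import Order.TTheory GRing.Theory Num.Theory.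
Import numFieldNormedType.Exports.

Local Open Scope classical_set_scope.
Local Open Scope ring_scope.

(** * Linearity of absolutely convergent sums *)

Section SumLinearity.
Context {R : realType} {T : choiceType}.
Implicit Types (D : set T) (u v w : T -> R) (f g : T -> R[i]).

Lemma esumZl D (a : R) (g : T -> \bar R) :
  0 <= a -> (forall t, 0 <= g t)%E ->
  (\esum_(t in D) (a%:E * g t) = a%:E * \esum_(t in D) g t)%E.
Proof.
move=> a0 g0; rewrite /esum -ereal_supZl//; last first.
  by apply/set0P; exists 0%E; exists set0; [exact: fsets_set0|rewrite fsbig_set0].
congr ereal_sup; rewrite image_comp; apply: eq_imagel => A _ /=.
by rewrite ge0_mule_fsumr.
Qed.

Lemma summable_esum_fin_num D w : summable D (EFin \o w) ->
  (forall t, 0 <= w t) -> (esum D (EFin \o w)) \is a fin_num.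
Proof.
rewrite summableE => sw w0; move: sw; congr (_ \is a fin_num).
by apply: eq_esum => t _; rewrite /= ger0_norm.
Qed.

Lemma summable_norm_le D u v : (forall t, `|u t| <= `|v t|) ->
  summable D (EFin \o v) -> summable D (EFin \o u).
Proof.
by move=> uv; apply: le_lt_trans; apply: le_esum => t _; rewrite /= lee_fin.
Qed.

Lemma summable_funrpos D u : summable D (EFin \o u) -> summable D (EFin \o u^\+).
Proof.
apply: summable_norm_le => t; rewrite /funrpos.
by case: (lerP (u t) 0) => // _; rewrite normr0.
Qed.

Lemma summable_funrneg D u : summable D (EFin \o u) -> summable D (EFin \o u^\-).
Proof.
apply: summable_norm_le => t; rewrite /funrneg.
by case: (lerP (- u t) 0) => // _; rewrite ?normr0// normrN.
Qed.

Lemma summable_EFinD D u v : summable D (EFin \o u) -> summable D (EFin \o v) ->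
  summable D (EFin \o (u \+ v)).
Proof. exact: summableD. Qed.

Lemma summable_EFinZ D a u : summable D (EFin \o u) ->
  summable D (EFin \o (a \*o u)).
Proof.
move=> su; rewrite /summable.
under eq_esum do rewrite /= normrM EFinM.
by rewrite esumZl// lte_mul_pinfty// lee_fin.
Qed.

(** The signed sum may be computed from any decomposition into a difference of
    nonnegative summable families, which is what makes [rsum] additive. *)
Lemma rsumB_nneg D u v : summable D (EFin \o u) -> summable D (EFin \o v) ->
  (forall t, 0 <= u t) -> (forall t, 0 <= v t) ->
  rsum D (u \- v) = fine (esum D (EFin \o u)) - fine (esum D (EFin \o v)).
Proof.
move=> su sv u0 v0; rewrite /rsum.
have -> : EFin \o (u \- v) = ((EFin \o u) \- (EFin \o v))%E by [].
rewrite [X in fine X](esumB su sv)//; try by move=> t _; rewrite /= lee_fin.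
by rewrite fineB// summable_esum_fin_num.
Qed.

Lemma fine_esumD D u v : summable D (EFin \o u) -> summable D (EFin \o v) ->
  (forall t, 0 <= u t) -> (forall t, 0 <= v t) ->
  fine (esum D (EFin \o (u \+ v))) =
  fine (esum D (EFin \o u)) + fine (esum D (EFin \o v)).
Proof.
move=> su sv u0 v0; rewrite -fineD ?summable_esum_fin_num//; congr fine.
by rewrite -esumD// => t _; rewrite /= lee_fin.
Qed.

Lemma rsum_posneg D u : summable D (EFin \o u) ->
  rsum D u = fine (esum D (EFin \o u^\+)) - fine (esum D (EFin \o u^\-)).
Proof.
move=> su; rewrite -(rsumB_nneg (summable_funrpos su) (summable_funrneg su))//.
by congr rsum; rewrite -[LHS]funrposBneg.
Qed.

Lemma funrposBnegE u t : u t = u^\+ t - u^\- t.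
Proof. by rewrite -[in LHS](funrposBneg u). Qed.

Lemma rsumD D u v : summable D (EFin \o u) -> summable D (EFin \o v) ->
  rsum D (u \+ v) = rsum D u + rsum D v.
Proof.
move=> su sv.
have [pu nu] := (summable_funrpos su, summable_funrneg su).
have [pv nv] := (summable_funrpos sv, summable_funrneg sv).
have -> : u \+ v = (u^\+ \+ v^\+) \- (u^\- \+ v^\-).
  by apply/funext => t /=; rewrite (funrposBnegE u) (funrposBnegE v); ring.
rewrite (rsumB_nneg (summable_EFinD pu pv) (summable_EFinD nu nv)); last 2 first.
- by move=> t; rewrite addr_ge0.
- by move=> t; rewrite addr_ge0.
rewrite (fine_esumD pu pv)// (fine_esumD nu nv)//.
by rewrite (rsum_posneg su) (rsum_posneg sv); ring.
Qed.

Lemma rsumN D u : summable D (EFin \o u) -> rsum D (\- u) = - rsum D u.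
Proof.
move=> su; have [pu nu] := (summable_funrpos su, summable_funrneg su).
have -> : \- u = u^\- \- u^\+.
  by apply/funext => t /=; rewrite (funrposBnegE u); ring.
by rewrite (rsumB_nneg nu pu)// (rsum_posneg su) opprB.
Qed.

Lemma rsumZ D a u : summable D (EFin \o u) -> rsum D (a \*o u) = a * rsum D u.
Proof.
have sc (b : R) (h : T -> R) : 0 <= b -> (forall t, 0 <= h t) ->
    summable D (EFin \o h) ->
    fine (esum D (EFin \o (b \*o h))) = b * fine (esum D (EFin \o h)).
  move=> b0 h0 sh.
  have /(congr1 fine) := @esumZl D b (EFin \o h) b0 (fun t => h0 t).
  by rewrite fineM ?summable_esum_fin_num.
have pos (b : R) (w : T -> R) : 0 <= b -> summable D (EFin \o w) ->
    rsum D (b \*o w) = b * rsum D w.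
  move=> b0 sw; have [pu nu] := (summable_funrpos sw, summable_funrneg sw).
  have -> : b \*o w = (b \*o w^\+) \- (b \*o w^\-).
    by apply/funext => t /=; rewrite (funrposBnegE w) mulrBr.
  rewrite (rsumB_nneg (summable_EFinZ b pu) (summable_EFinZ b nu)); last 2 first.
  - by move=> t; rewrite mulr_ge0.
  - by move=> t; rewrite mulr_ge0.
  by rewrite (sc _ _ b0 _ pu)// (sc _ _ b0 _ nu)// (rsum_posneg sw) mulrBr.
move=> su; have [a0|a0] := leP 0 a; first exact: pos.
have -> : a \*o u = \- ((- a) \*o u).
  by apply/funext => t /=; rewrite mulNr opprK.
rewrite (rsumN (summable_EFinZ _ su)).
by rewrite pos ?oppr_ge0 ?ltW// mulNr opprK.
Qed.

Lemma modc_Re (z : R[i]) : `|complex.Re z| <= modc z.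
Proof.
by case: z => x y /=; rewrite -sqrtr_sqr ler_wsqrtr// lerDl sqr_ge0.
Qed.

Lemma modc_Im (z : R[i]) : `|complex.Im z| <= modc z.
Proof.
by case: z => x y /=; rewrite -sqrtr_sqr ler_wsqrtr// lerDr sqr_ge0.
Qed.

Lemma modc_ge0 (z : R[i]) : 0 <= modc z.
Proof. by case: z => x y /=; exact: sqrtr_ge0. Qed.

Lemma csummable_Re D f : csummable D f ->
  summable D (EFin \o (fun t => complex.Re (f t))).
Proof.
apply: le_lt_trans; apply: le_esum => t _; rewrite /= lee_fin.
by rewrite [leRHS]ger0_norm ?modc_ge0 ?modc_Re//.
Qed.

Lemma csummable_Im D f : csummable D f ->
  summable D (EFin \o (fun t => complex.Im (f t))).
Proof.
apply: le_lt_trans; apply: le_esum => t _; rewrite /= lee_fin.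
by rewrite [leRHS]ger0_norm ?modc_ge0 ?modc_Im//.
Qed.

Lemma csumD D f g : csummable D f -> csummable D g ->
  csum D (fun t => f t + g t) = csum D f + csum D g.
Proof.
move=> sf sg; rewrite /csum.
under [X in Complex (rsum _ X) _]funext do rewrite raddfD.
under [X in Complex _ (rsum _ X)]funext do rewrite raddfD.
by rewrite !rsumD//; [exact: csummable_Im|exact: csummable_Im|
  exact: csummable_Re|exact: csummable_Re].
Qed.

Lemma csumZ D (c : R[i]) f : csummable D f ->
  csum D (fun t => c * f t) = c * csum D f.
Proof.
move=> sf; have [sr si] := (csummable_Re sf, csummable_Im sf).
case: c => a b; rewrite /csum.
rewrite [X in Complex (rsum _ X) _](_ : _ =
  (a \*o (fun t => complex.Re (f t))) \+ (- b \*o (fun t => complex.Im (f t))));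
  last first.
  by apply/funext => t /=; case: (f t) => x y /=; ring.
rewrite [X in Complex _ (rsum _ X)](_ : _ =
  (a \*o (fun t => complex.Im (f t))) \+ (b \*o (fun t => complex.Re (f t))));
  last first.
  by apply/funext => t /=; case: (f t) => x y /=; ring.
rewrite !rsumD ?rsumZ//; try exact: summable_EFinZ.
by apply/eqP; rewrite eq_complex/=; apply/andP; split; apply/eqP; ring.
Qed.

End SumLinearity.

(** * Square-summable families and two-coordinate vectors *)

Section Ell2.
Context {R : realType} {K : fieldType}.
Implicit Types (F G : coefs R K) (x y z c : R[i]) (al be : K).

(** The squared modulus, in the polynomial form on which ring reasoning
    applies. *)
Definition sqm z : R := complex.Re z ^+ 2 + complex.Im z ^+ 2.

Lemma sqr_modc z : modc z ^+ 2 = sqm z.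
Proof. by case: z => x y /=; rewrite sqr_sqrtr// addr_ge0 ?sqr_ge0. Qed.

Lemma sqm_ge0 z : 0 <= sqm z.
Proof. by rewrite addr_ge0 ?sqr_ge0. Qed.

Lemma sqm_eq0 z : (sqm z == 0) = (z == 0).
Proof. by rewrite paddr_eq0 ?sqr_ge0// !sqrf_eq0 eq_complex. Qed.

Lemma sqmM x y : sqm (x * y) = sqm x * sqm y.
Proof. by case: x y => [a b] [c d]; rewrite /sqm/=; ring. Qed.

Lemma sqm0 : sqm 0 = 0.
Proof. by apply/eqP; rewrite sqm_eq0. Qed.

Lemma sqmD_le x y : sqm (x + y) <= 2 * sqm x + 2 * sqm y.
Proof.
case: x y => [a b] [c d]; rewrite /sqm/=.
by have := sqr_ge0 (a - c); have := sqr_ge0 (b - d); nra.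
Qed.

(** The squared norm of [F]; it is 0, and carries no information, when [F] is
    not in [ell2]. *)
Definition nsq F : R := fine (\esum_(t in setT) (sqm (F t))%:E).

Lemma ell2E F : ell2 F <-> (\esum_(t in setT) (sqm (F t))%:E < +oo)%E.
Proof.
by rewrite /ell2/=; under eq_esum do rewrite sqr_modc.
Qed.

Lemma hnormE F : hnorm F = Num.sqrt (nsq F).
Proof. by rewrite /hnorm; under eq_esum do rewrite sqr_modc. Qed.

Lemma ell2_nsq F : ell2 F -> (\esum_(t in setT) (sqm (F t))%:E = (nsq F)%:E)%E.
Proof.
move=> /ell2E Foo; rewrite /nsq fineK// ge0_fin_numE//.
by apply: esum_ge0 => t _; rewrite lee_fin sqm_ge0.
Qed.

Lemma ell2Z c F : ell2 F -> ell2 (c *: F).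
Proof.
move=> F2; apply/ell2E.
under eq_esum do rewrite /= sqmM EFinM.
by rewrite esumZl ?sqm_ge0 ?ell2_nsq -?EFinM ?ltry// => t; rewrite lee_fin sqm_ge0.
Qed.

Lemma nsqZ c F : ell2 F -> nsq (c *: F) = sqm c * nsq F.
Proof.
move=> F2; rewrite {1}/nsq.
under eq_esum do rewrite /= sqmM EFinM.
by rewrite esumZl ?sqm_ge0 ?ell2_nsq -?EFinM ?ltry// => t; rewrite lee_fin sqm_ge0.
Qed.

Lemma ell2D F G : ell2 F -> ell2 G -> ell2 (F + G).
Proof.
move=> F2 G2; apply/ell2E.
apply: (@le_lt_trans _ _ (\esum_(t in setT) (2%:E * (sqm (F t))%:E +
    2%:E * (sqm (G t))%:E))%E).
  by apply: le_esum => t _; rewrite -!EFinM -EFinD lee_fin sqmD_le.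
rewrite esumD; last 2 first.
- by move=> t _; rewrite mule_ge0 ?lee_fin ?sqm_ge0.
- by move=> t _; rewrite mule_ge0 ?lee_fin ?sqm_ge0.
by rewrite !esumZl ?ell2_nsq -?EFinM ?ltry// => t; rewrite lee_fin sqm_ge0.
Qed.

Lemma esum_pair (al be : K) (g : K -> \bar R) : al != be ->
  (forall t, 0 <= g t)%E -> (forall t, t != al -> t != be -> g t = 0)%E ->
  (\esum_(t in setT) g t = g al + g be)%E.
Proof.
move=> ab g0 gz.
rewrite (_ : \esum_(t in setT) g t = \esum_(t in setT)
   ((if t == al then g al else 0) + (if t == be then g be else 0)))%E; last first.
  apply: eq_esum => t _; have [->|ta] := eqVneq t al.
    by rewrite (negbTE ab) adde0.
  by have [->|tb] := eqVneq t be; rewrite add0e// gz.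
rewrite esumD; try by move=> t _; case: ifP.
rewrite (@esum_monomial R K al); last 2 first.
- by move=> t; case: ifP.
- by move=> t /negbTE->.
rewrite (@esum_monomial R K be); last 2 first.
- by move=> t; case: ifP.
- by move=> t /negbTE->.
by rewrite !eqxx.
Qed.

Lemma pair_le_nsq F al be : al != be -> ell2 F ->
  sqm (F al) + sqm (F be) <= nsq F.
Proof.
move=> ab F2; rewrite -lee_fin -ell2_nsq// EFinD.
pose g t : \bar R := (if (t == al) || (t == be) then (sqm (F t))%:E else 0)%E.
have -> : ((sqm (F al))%:E + (sqm (F be))%:E = \esum_(t in setT) g t)%E.
  rewrite (@esum_pair al be)// /g ?eqxx ?orbT//.
  - by move=> t; case: ifP; rewrite ?lee_fin ?sqm_ge0.
  - by move=> t /negbTE-> /negbTE->.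
by apply: le_esum => t _; rewrite /g; case: ifP; rewrite ?lee_fin ?sqm_ge0.
Qed.

Lemma neq_add1 al : al != al + 1.
Proof. by rewrite -subr_eq0 opprD addNKr oppr_eq0 oner_eq0. Qed.

Lemma coord_le_nsq F al : ell2 F -> sqm (F al) <= nsq F.
Proof.
move=> F2.
by apply: le_trans (pair_le_nsq (neq_add1 al) F2); rewrite lerDl sqm_ge0.
Qed.

Lemma nsq_gt0 F : ell2 F -> F <> 0 -> 0 < nsq F.
Proof.
move=> F2 F0; rewrite ltNge; apply/negP => Fle; apply: F0; apply/funext => t.
apply/eqP; rewrite -sqm_eq0 eq_le sqm_ge0 andbT.
exact: le_trans (coord_le_nsq t F2) Fle.
Qed.

(** The vector x rho^al + y rho^be; it is meant for [al != be]. *)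
Definition pairv al be x y : coefs R K :=
  x *: monomial R al + y *: monomial R be.

Lemma pairvE al be x y t :
  pairv al be x y t = x * (t == al)%:R + y * (t == be)%:R.
Proof. by []. Qed.

Lemma pairvl al be x y : al != be -> pairv al be x y al = x.
Proof. by move=> ab; rewrite pairvE eqxx (negbTE ab) mulr1 mulr0 addr0. Qed.

Lemma pairvr al be x y : al != be -> pairv al be x y be = y.
Proof. by move=> ab; rewrite pairvE eqxx eq_sym (negbTE ab) mulr1 mulr0 add0r. Qed.

Lemma pairv_out al be x y t : t != al -> t != be -> pairv al be x y t = 0.
Proof. by rewrite pairvE => /negbTE-> /negbTE->; rewrite !mulr0 addr0. Qed.

Lemma eq_pairv F al be : al != be -> (forall t, t != al -> t != be -> F t = 0) ->
  F = pairv al be (F al) (F be).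
Proof.
move=> ab F0; apply/funext => t.
have [->|ta] := eqVneq t al; first by rewrite pairvl.
have [->|tb] := eqVneq t be; first by rewrite pairvr.
by rewrite pairv_out// F0.
Qed.

Lemma ell2_pairv al be x y : ell2 (pairv al be x y).
Proof.
have m (a : K) : ell2 (monomial R a).
  by apply/ell2E; rewrite (@esum_monomial R K a) ?ltry// => t;
     rewrite ?lee_fin ?sqm_ge0// /monomial => /negbTE->; rewrite sqm0.
by apply: ell2D; apply: ell2Z.
Qed.

Lemma nsq_pairv al be x y : al != be ->
  nsq (pairv al be x y) = sqm x + sqm y.
Proof.
move=> ab; rewrite /nsq (@esum_pair al be)//.
- by rewrite pairvl// pairvr.
- by move=> t; rewrite lee_fin sqm_ge0.
- by move=> t ta tb; rewrite pairv_out// sqm0.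
Qed.

Lemma csummable_monomial c al : csummable setT (c *: monomial R al).
Proof.
rewrite /csummable /summable (@esum_monomial R K al) ?ltry// => t.
move=> /negbTE ta; have -> : (c *: monomial R al) t = 0.
  by rewrite -[LHS]/(c * (t == al)%:R) ta mulr0.
by rewrite Normc.normc0 abse0.
Qed.

Lemma csum_pairv al be x y : csum setT (pairv al be x y) = x + y.
Proof.
rewrite -[X in csum _ X]/(fun t => (x *: monomial R al) t + (y *: monomial R be) t).
by rewrite csumD ?csum_monomial//; exact: csummable_monomial.
Qed.

Lemma csummable_pairv al be x y : csummable setT (pairv al be x y).
Proof.
have := summableD (csummable_monomial x al) (csummable_monomial y be).
apply: le_lt_trans; apply: le_esum => t _; rewrite /= lee_fin.
rewrite [leLHS]ger0_norm ?modc_ge0//.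
by rewrite [leRHS]ger0_norm ?addr_ge0 ?modc_ge0// le_normcD.
Qed.

Lemma inner_pairv F al be x y : al != be ->
  inner F (pairv al be x y) = F al * conjc x + F be * conjc y.
Proof.
move=> ab; rewrite -(csum_pairv al be); congr csum.
rewrite [LHS](@eq_pairv _ al be)// ?pairvl ?pairvr// => t ta tb.
by rewrite pairv_out// conjc0 mulr0.
Qed.

Lemma sqm_conjc z : sqm (conjc z) = sqm z.
Proof. by case: z => a b; rewrite /sqm/= sqrrN. Qed.

(** The Cauchy-Schwarz inequality against a vector with two coordinates. *)
Lemma sqm_inner_pairv F al be x y : al != be -> ell2 F ->
  sqm (F al * conjc x + F be * conjc y) <= nsq F * (sqm x + sqm y).
Proof.
move=> ab F2; apply: le_trans (ler_wpM2r _ (pair_le_nsq ab F2)); last first.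
  by rewrite addr_ge0 ?sqm_ge0.
rewrite -subr_ge0; case: (F al) (F be) x y => [a b] [c d] [e f] [g h].
rewrite /sqm/=.
(* Lagrange's identity *)
rewrite [leRHS](_ : _ = (a * g - b * h - c * e + d * f) ^+ 2 +
  (b * g + a * h - d * e - c * f) ^+ 2); last by ring.
by rewrite addr_ge0 ?sqr_ge0.
Qed.

End Ell2.

(** * Lines and the Fubini-Study distance *)

Section Lines.
Context {R : realType} {K : fieldType}.
Implicit Types (F G : coefs R K) (x y z c : R[i]) (al be : K) (P Q : PH R K).

Lemma vecs_lineP P : exists2 F, ell2 F /\ F <> 0 & vecs P = line F.
Proof. by have [F F2 e] := set_valP P; exists F. Qed.

Lemma vecs_ell2 P F : vecs P F -> ell2 F.
Proof.
by have [F0 [F02 _] ->] := vecs_lineP P; case=> c _ <-; exact: ell2Z.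
Qed.

Lemma vecs_neq0 P F : vecs P F -> F <> 0.
Proof.
have [F0 [_ F00] ->] := vecs_lineP P; case=> c /= c0 <- cF; apply: F00.
by rewrite /= -(scale1r F0) -(mulVf c0) -scalerA cF scaler0.
Qed.

Lemma vecs_nsq_gt0 P F : vecs P F -> 0 < nsq F.
Proof. by move=> PF; apply: nsq_gt0; [exact: vecs_ell2 PF|exact: vecs_neq0 PF]. Qed.

Lemma vecs_colinear P F G : vecs P F -> vecs P G -> exists2 c, c != 0 & G = c *: F.
Proof.
have [F0 _ ->] := vecs_lineP P; case=> c /= c0 <- [d /= d0 <-].
exists (d / c); first by rewrite mulf_neq0 ?invr_neq0.
by rewrite scalerA divfK.
Qed.

Lemma vecsZ P F c : c != 0 -> vecs P F -> vecs P (c *: F).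
Proof.
have [F0 _ ->] := vecs_lineP P => c0 [d /= d0 <-].
by exists (c * d); rewrite /= ?mulf_neq0// scalerA.
Qed.

Lemma vecs_inj P Q F : vecs P F -> vecs Q F -> P = Q.
Proof.
move=> PF QF; apply: val_inj; apply/seteqP; split => G GP.
- by have [c c0 ->] := vecs_colinear PF GP; exact: vecsZ.
- by have [c c0 ->] := vecs_colinear QF GP; exact: vecsZ.
Qed.

Lemma vecs_ex F : ell2 F -> F <> 0 -> exists P : PH R K, vecs P F.
Proof.
move=> F2 F0; have FP : PH_lines (line F) by exists F.
exists (SigSub (mem_set FP)).
by exists 1; rewrite /= ?oner_neq0 ?scale1r.
Qed.

Lemma vecs_rep P : vecs P (rep P).
Proof.
rewrite /rep; case: xgetP => [F -> //|no].
have [F _ PF] := vecs_lineP P; exfalso; apply: (no F).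
by rewrite PF; exists 1; rewrite /= ?oner_neq0 ?scale1r.
Qed.

Lemma vecs_mono al : vecs (mono_PH R al) (monomial R al).
Proof. by exists 1; rewrite /= ?oner_neq0 ?scale1r. Qed.

(** The Fubini-Study distance to a line supported on two coordinates, expressed
    by arbitrary representatives instead of the chosen ones. *)
Lemma cos_fs_dist P Q F al be x y : al != be ->
  vecs P F -> vecs Q (pairv al be x y) ->
  cos (fs_dist P Q) ^+ 2 =
  sqm (F al * conjc x + F be * conjc y) / (nsq F * (sqm x + sqm y)).
Proof.
move=> ab PF QG; have [PF' QG'] := (vecs_rep P, vecs_rep Q).
have [c c0 eP] := vecs_colinear PF PF'.
have [d d0 eQ] := vecs_colinear QG QG'.
have {}eQ : rep Q = pairv al be (d * x) (d * y).
  by rewrite eQ /pairv scalerDr !scalerA.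
have F2 := vecs_ell2 PF'.
have nF := vecs_nsq_gt0 PF'; have nG := vecs_nsq_gt0 QG'.
have CS := sqm_inner_pairv (d * x) (d * y) ab F2.
move: nG; rewrite /fs_dist eQ inner_pairv// !hnormE nsq_pairv// => nG.
set u := _ + _ in CS *; set n := sqm _ + _ in CS nG *.
have h0 : 0 <= modc u / (Num.sqrt (nsq (rep P)) * Num.sqrt n).
  by rewrite divr_ge0 ?modc_ge0// mulr_ge0 ?sqrtr_ge0.
have hsq : (modc u / (Num.sqrt (nsq (rep P)) * Num.sqrt n)) ^+ 2 =
    sqm u / (nsq (rep P) * n).
  by rewrite expr_div_n exprMn !sqr_sqrtr ?ltW// sqr_modc.
rewrite acosK; last first.
  rewrite in_itv/= (le_trans _ h0) ?lerN10//=.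
  by rewrite -(@expr_le1 _ 2)// hsq ler_pdivrMr ?mulr_gt0// mul1r.
rewrite hsq /u /n eP nsqZ; last exact: vecs_ell2 PF.
have -> : (c *: F) al * conjc (d * x) + (c *: F) be * conjc (d * y) =
    (c * conjc d) * (F al * conjc x + F be * conjc y).
  rewrite !rmorphM/= -[(c *: F) al]/(c * F al) -[(c *: F) be]/(c * F be).
  by ring.
rewrite !sqmM sqm_conjc.
have cn : sqm c != 0 by rewrite sqm_eq0.
have dn : sqm d != 0 by rewrite sqm_eq0.
have n0 : sqm x + sqm y != 0.
  by move: nG; rewrite /n !sqmM -mulrDr => /lt0r_neq0;
    rewrite mulf_eq0 negb_or => /andP[].
have F0 := lt0r_neq0 (vecs_nsq_gt0 PF).
by rewrite -mulrDr; field; rewrite F0 n0 cn dn.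
Qed.

End Lines.

(** * Antiholomorphic functions *)

Section Antiholomorphic.
Context {R : realType}.
Local Notation C := R[i].

(** If [p] is differentiable at 0 with [p 0 != 0], then z |-> conj(z) p(z) is not:
    its difference quotient tends to [p 0] along the real axis and to [- p 0]
    along the imaginary axis. *)
Lemma antiholomorphic_no_derivative (p : C -> C) (d d' : C) : p 0 != 0 ->
  ~ (forall e : R, 0 < e -> exists2 del : R, 0 < del &
      forall z : C, z != 0 -> modc z < del ->
        modc (z^-1 * (p z - p 0) - d) < e /\
        modc (z^-1 * (conjc z * p z) - d') < e).
Proof.
move=> p0 H; set m := modc (p 0).
have m0 : 0 < m.
  rewrite lt_def modc_ge0 andbT; apply: contra p0 => /eqP h.
  by apply/eqP; exact: Normc.eq0_normc.
have [|del del0 Hd] := H (m / 4); first by rewrite divr_gt0.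
have D0 : 0 < modc d + m / 4 by rewrite ltr_wpDl ?modc_ge0// divr_gt0.
pose t := Num.min (del / 2) (m / 4 / (modc d + m / 4)).
have t0 : 0 < t by rewrite /t lt_min !divr_gt0.
have td : t < del by rewrite /t gt_min; apply/orP; left; lra.
have tm : t * (modc d + m / 4) <= m / 4.
  by rewrite -ler_pdivlMr// /t ge_min lexx orbT.
have near (z : C) : modc z = t -> modc (p z - p 0) <= m / 4 /\
    modc (z^-1 * conjc z * p z - d') < m / 4.
  move=> zt; have z0 : z != 0.
    by apply: contraTneq t0 => z0; rewrite -zt z0 Normc.normc0 ltxx.
  have [h1 h2] := Hd z z0 (eq_ind_r (fun s => s < del) td zt).
  split; last by rewrite -mulrA.
  have -> : p z - p 0 = z * ((z^-1 * (p z - p 0) - d) + d).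
    by rewrite subrK mulrA divff// mul1r.
  rewrite Normc.normcM zt; apply: le_trans tm.
  rewrite ler_pM2l//; apply: le_trans (le_normcD _ _) _.
  by rewrite addrC lerD2l ltW.
have nr : modc (Complex t 0) = t.
  by rewrite /= expr0n/= addr0 sqrtr_sqr ger0_norm// ltW.
have ni : modc (Complex 0 t) = t.
  by rewrite /= expr0n/= add0r sqrtr_sqr ger0_norm// ltW.
have [a1 a2] := near _ nr; have [b1 b2] := near _ ni.
(* The two approaches to 0, of common modulus t. *)
set zr := Complex t 0 in a1 a2 nr; set zi := Complex 0 t in b1 b2 ni.
have zr0 : zr != 0 by rewrite eq_complex/= (gt_eqF t0).
have zi0 : zi != 0 by rewrite eq_complex/= (gt_eqF t0) andbF.
have er : conjc zr = zr by rewrite /zr/= oppr0.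
have ei : conjc zi = - zi.
  by apply/eqP; rewrite eq_complex/= oppr0 !eqxx.
rewrite er mulVf// mul1r in a2.
rewrite ei mulrN mulVf// mulN1r in b2.
(* 2 p(0) is a combination of four quantities of modulus at most |p(0)| / 4. *)
have : 2 * m <= m / 4 + m / 4 + m / 4 + m / 4 :> R.
  have -> : 2 * m = modc ((p zr - d') - (- p zi - d') - (p zr - p 0) - (p zi - p 0)).
    rewrite (_ : _ - (p zi - p 0) = p 0 + p 0); last by ring.
    by rewrite -mulr2n normcMn mulr_natl.
  apply: le_trans (le_normcD _ _) _; rewrite normcN; apply: lerD => //.
  apply: le_trans (le_normcD _ _) _; rewrite normcN; apply: lerD => //.
  apply: le_trans (le_normcD _ _) _; rewrite normcN; apply: lerD; exact: ltW.
lra.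
Qed.

End Antiholomorphic.

(** * Isometries fixing the coordinate lines *)

Section Algebra.
Context {R : realType}.
Implicit Types a b z w : R[i].

Lemma conjugate_or_equal z w : sqm w = sqm z ->
  sqm (1 - w) = sqm (1 - z) -> w = z \/ w = conjc z.
Proof.
case: z w => [a b] [c d]; rewrite /sqm/= => h1 h2.
have ac : c = a by nra.
have : (d - b) * (d + b) = 0 by rewrite ac in h1; nra.
move/eqP; rewrite mulf_eq0 => /orP[] /eqP h; [left|right]; congr Complex => //; lra.
Qed.

(** The real and imaginary parts of b conj(a) are linear combinations of the
    squared moduli of a, b, a - b and a - i b; [m] and [n] rescale the latter. *)
Lemma polarization (a b a' b' : R[i]) (m n : R) :
  sqm a * m = sqm a' * n -> sqm b * m = sqm b' * n ->
  sqm (a - b) * m = sqm (a' - b') * n ->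
  sqm (a - b * 'i%C) * m = sqm (a' - b' * 'i%C) * n ->
  b * conjc a * (m%:C)%C = b' * conjc a' * (n%:C)%C.
Proof.
case: a b a' b' => [a1 a2] [b1 b2] [c1 c2] [d1 d2]; rewrite /sqm/= => h1 h2 h3 h4.
by apply/eqP; rewrite eq_complex/=; apply/andP; split; apply/eqP; lra.
Qed.

End Algebra.

Section Isometry.
Context (R : realType) (K : fieldType) (V : PH R K -> PH R K).
Implicit Types (F G : coefs R K) (x y z c : R[i]) (al be : K) (P Q : PH R K).
Hypothesis Vdist : forall P Q, fs_dist (V P) (V Q) = fs_dist P Q.
Hypothesis Vmono : forall al, V (mono_PH R al) = mono_PH R al.

Lemma pairv_neq0 al be x y : al != be -> x != 0 -> pairv al be x y <> 0.
Proof. by move=> ab /eqP x0 /(congr1 (fun F => F al)); rewrite pairvl. Qed.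

(** Invariance of the distance between a line and a two-coordinate line,
    cleared of denominators. *)
Lemma isometry_pairv P Q F G al be x y x' y' : al != be ->
  vecs P F -> vecs (V P) G ->
  vecs Q (pairv al be x y) -> vecs (V Q) (pairv al be x' y') ->
  sqm (F al * conjc x + F be * conjc y) * (nsq G * (sqm x' + sqm y')) =
  sqm (G al * conjc x' + G be * conjc y') * (nsq F * (sqm x + sqm y)).
Proof.
move=> ab PF PG Qx Qx'.
have h1 := cos_fs_dist ab PF Qx; have h2 := cos_fs_dist ab PG Qx'.
rewrite Vdist in h2; rewrite h1 in h2.
have := vecs_nsq_gt0 Qx; have := vecs_nsq_gt0 Qx'; rewrite !nsq_pairv// => n1 n2.
apply/eqP; rewrite -eqr_div ?h2//; rewrite mulf_neq0// lt0r_neq0//.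
  exact: vecs_nsq_gt0 PF.
exact: vecs_nsq_gt0 PG.
Qed.

Lemma isometry_coord P F G al : vecs P F -> vecs (V P) G ->
  sqm (F al) * nsq G = sqm (G al) * nsq F.
Proof.
move=> PF PG.
(* The second index is any one distinct from al: its coefficient is 0. *)
have mE : monomial R al = pairv al (al + 1) 1 0.
  by rewrite /pairv scale1r scale0r addr0.
have M : vecs (mono_PH R al) (pairv al (al + 1) 1 0).
  by rewrite -mE; exact: vecs_mono.
have := isometry_pairv (neq_add1 al) PF PG M; rewrite Vmono => /(_ _ _ M).
rewrite conjc1 conjc0 !mulr0 !mulr1 !addr0 sqm0 addr0.
by rewrite /sqm/= expr1n expr0n addr0 !mulr1.
Qed.

Lemma isometry_coord0 P F G al : vecs P F -> vecs (V P) G ->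
  (G al == 0) = (F al == 0).
Proof.
move=> PF PG; have h := isometry_coord al PF PG.
have nF := lt0r_neq0 (vecs_nsq_gt0 PF); have nG := lt0r_neq0 (vecs_nsq_gt0 PG).
apply/idP/idP => /eqP e; move/eqP: h; rewrite e sqm0 mul0r.
  by rewrite mulf_eq0 (negbTE nG) orbF sqm_eq0.
by rewrite eq_sym mulf_eq0 (negbTE nF) orbF sqm_eq0.
Qed.

Lemma isometry_pair P al be z : al != be -> vecs P (pairv al be 1 z) ->
  exists w, sqm w = sqm z /\ vecs (V P) (pairv al be 1 w).
Proof.
move=> ab PF; have PG := vecs_rep (V P); set G := rep _ in PG.
have eG : G = pairv al be (G al) (G be).
  apply: eq_pairv => // t ta tb; apply/eqP.
  by rewrite (isometry_coord0 t PF PG) pairv_out.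
have h := isometry_coord al PF PG.
rewrite eG nsq_pairv// nsq_pairv// !pairvl// in h.
have a0 : G al != 0 by rewrite (isometry_coord0 _ PF PG) pairvl// oner_eq0.
have s1 : sqm (1 : R[i]) = 1 by rewrite /sqm/= expr1n expr0n addr0.
exists (G be / G al); split.
  apply: (@mulfI _ (sqm (G al))); first by rewrite sqm_eq0.
  rewrite -sqmM [G al * _]mulrC divfK//; rewrite s1 in h; lra.
have -> : pairv al be 1 (G be / G al) = (G al)^-1 *: G.
  by rewrite [X in _ *: X]eG /pairv scalerDr !scalerA mulVf// mulrC [_ * G be]mulrC.
by apply: vecsZ; rewrite ?invr_neq0.
Qed.

Hypothesis Vminus : forall P al be, al != be -> vecs P (pairv al be 1 (-1)) ->
  V P = P.

Lemma isometry_pair_conj P al be z : al != be -> vecs P (pairv al be 1 z) ->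
  exists2 w, w = z \/ w = conjc z & vecs (V P) (pairv al be 1 w).
Proof.
move=> ab PF; have [w [wz PG]] := isometry_pair ab PF.
exists w => //; apply: conjugate_or_equal => //.
have [Q QF] := vecs_ex (ell2_pairv al be 1 (-1))
    (pairv_neq0 (y := -1) ab (oner_neq0 _)).
have VQ := Vminus ab QF.
have := isometry_pairv ab PF PG QF; rewrite VQ => /(_ _ _ QF).
rewrite !nsq_pairv// !pairvl// !pairvr// conjc1 rmorphN rmorph1 !mulr1 !mulrN1 wz.
have s0 : sqm (1 : R[i]) + sqm z != 0.
  by have := vecs_nsq_gt0 PF; rewrite nsq_pairv// => /lt0r_neq0.
have t0 : sqm (1 : R[i]) + sqm (- 1 : R[i]) != 0.
  by have := vecs_nsq_gt0 QF; rewrite nsq_pairv// => /lt0r_neq0.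
by move=> /(mulIf (mulf_neq0 s0 t0)).
Qed.

(** Conjugating the parameter i forces conjugating every parameter z. *)
Lemma isometry_conj P Q al be z : al != be ->
  vecs P (pairv al be 1 'i%C) -> vecs (V P) (pairv al be 1 (- 'i%C)) ->
  vecs Q (pairv al be 1 z) -> vecs (V Q) (pairv al be 1 (conjc z)).
Proof.
move=> ab PF PG QF; have [w [] -> // QG] := isometry_pair_conj ab QF.
have := isometry_pairv ab QF QG PF PG.
rewrite !nsq_pairv// !pairvl// !pairvr//.
case: z QF QG => x y QF QG; rewrite /sqm/= => h.
suff y0 : y = 0 by rewrite y0 oppr0; move: QG; rewrite y0.
have nz : (1 + (x ^+ 2 + y ^+ 2)) * (1 + 1) != 0 :> R.
  by rewrite lt0r_neq0// mulr_gt0// ltr_pwDl// addr_ge0 ?sqr_ge0.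
suff : ((1 + (x ^+ 2 + y ^+ 2)) * (1 + 1)) * y = 0.
  by move/eqP; rewrite mulf_eq0 (negbTE nz) => /eqP.
lra.
Qed.

Hypothesis Vholo : holomorphic V.

Lemma isometry_fix_i P al be : al != be -> vecs P (pairv al be 1 'i%C) ->
  vecs (V P) (pairv al be 1 'i%C).
Proof.
move=> ab PF; have [w [] -> // PG] := isometry_pair_conj ab PF.
have {}PG : vecs (V P) (pairv al be 1 (- 'i%C)).
  rewrite (_ : - 'i%C = conjc 'i%C)//.
  by apply/eqP; rewrite eq_complex/= oppr0 !eqxx.
exfalso.
have m2 a : ell2 (monomial R (a : K)) := vecs_ell2 (vecs_mono a).
have [Phi [D [D2 nearPhi lim]]] := Vholo (m2 al) (vecs_neq0 (vecs_mono al)) (m2 be).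
(* Where Phi lifts V, it is Phi(z)_al (rho^al + conj(z) rho^be). *)
have key (z : R[i]) : (forall P, vecs P (monomial R al + z *: monomial R be) ->
     vecs (V P) (Phi z)) ->
   [/\ ell2 (Phi z), Phi z al != 0 & Phi z be = conjc z * Phi z al].
  rewrite -{1}[monomial R al]scale1r => H.
  have [Q Qz] := vecs_ex (ell2_pairv al be 1 z)
    (pairv_neq0 (y := z) ab (oner_neq0 _)).
  have QPhi := H _ Qz; have Qc := isometry_conj ab PF PG Qz.
  have [c c0 e] := vecs_colinear Qc QPhi.
  have el : Phi z al = c by rewrite e -[LHS]/(c * pairv _ _ _ _ _) pairvl// mulr1.
  have er : Phi z be = c * conjc z by rewrite e -[LHS]/(c * pairv _ _ _ _ _) pairvr.
  by split; [exact: vecs_ell2 QPhi | rewrite el | rewrite el er mulrC].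
have [P02 P0al P0be] := key 0 (nbhs_singleton nearPhi).
apply: (@antiholomorphic_no_derivative _ (fun z => Phi z al) (D al) (D be)) => //.
move=> e e0.
move/cvgrPdist_lt: lim => /(_ e e0) lim.
have {lim} : \forall z \near (0 : R[i]^o),
   (forall P, vecs P (monomial R al + z *: monomial R be) -> vecs (V P) (Phi z)) /\
   (z != 0 -> `|0 - hnorm (z^-1 *: (Phi z - Phi 0) - D)| < e).
  exact: filterI nearPhi lim.
case/nbhs_ballP => r /= r0 Hr; exists (complex.Re r).
  by move: r0; rewrite /= ltcE => /andP[].
move=> z z0 zr.
have [|Hz /(_ z0)] := Hr z.
  rewrite -ball_normE/= sub0r normrN.
  case: r r0 zr {Hr} => r1 r2 /=; rewrite ltcE/= => /andP[/eqP-> _] zr.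
  by rewrite ltcR.
have [Pz2 _ Pzbe] := key z Hz.
set h := _ - D; rewrite sub0r normrN.
(* hnorm controls the coordinates only on ell2. *)
have h2 : ell2 h.
  rewrite /h; apply: ell2D; last by rewrite -scaleN1r; exact: ell2Z.
  by apply: ell2Z; apply: ell2D => //; rewrite -scaleN1r; exact: ell2Z.
have hle t : modc (h t) <= hnorm h.
  rewrite hnormE -[leLHS]ger0_norm ?modc_ge0// -sqrtr_sqr ler_wsqrtr//.
  by rewrite sqr_modc coord_le_nsq.
rewrite ger0_norm ?sqrtr_ge0// => he; split.
  exact: le_lt_trans (hle al) he.
have := le_lt_trans (hle be) he.
rewrite /h -[X in modc X]/(z^-1 * (Phi z be - Phi 0 be) - D be).
by rewrite Pzbe P0be conjc0 mul0r subr0.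
Qed.

Lemma isometry_fix P : V P = P.
Proof.
have PF := vecs_rep P; have PG := vecs_rep (V P).
set F := rep P in PF; set G := rep (V P) in PG.
set n := nsq F; set m := nsq G.
have crd a : sqm (F a) * m = sqm (G a) * n := isometry_coord a PF PG.
have s1 : sqm (1 : R[i]) + sqm (-1 : R[i]) != 0.
  by rewrite /sqm/= oppr0 expr0n sqrrN expr1n !addr0 -[1 + 1]/(2 : R) pnatr_eq0.
have si : sqm (1 : R[i]) + sqm ('i%C : R[i]) != 0.
  by rewrite /sqm/= expr0n expr1n addr0 add0r -[1 + 1]/(2 : R) pnatr_eq0.
have prod al be : al != be ->
    F be * conjc (F al) * (m%:C)%C = G be * conjc (G al) * (n%:C)%C.
  move=> ab; apply: polarization => //.
    have [Q QF] := vecs_ex (ell2_pairv al be 1 (-1))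
    (pairv_neq0 (y := -1) ab (oner_neq0 _)).
    have VQ := Vminus ab QF.
    have := isometry_pairv ab PF PG QF; rewrite VQ => /(_ _ _ QF).
    by rewrite conjc1 rmorphN rmorph1 !mulr1 !mulrN1 !mulrA => /(mulIf s1).
  have [Q QF] := vecs_ex (ell2_pairv al be 1 'i%C)
    (pairv_neq0 (y := 'i%C) ab (oner_neq0 _)).
  have := isometry_pairv ab PF PG QF (isometry_fix_i ab QF).
  have -> : conjc 'i%C = - 'i%C :> R[i].
    by apply/eqP; rewrite eq_complex/= oppr0 !eqxx.
  by rewrite conjc1 !mulr1 !mulrN !mulrA => /(mulIf si).
have [al Fal] : exists al, F al != 0.
  apply: contrapT => no; apply: (vecs_neq0 PF); apply/funext => t.
  by apply/eqP/negP => Ft; apply: no; exists t; apply/negP.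
have Gal : G al != 0 by rewrite (isometry_coord0 _ PF PG).
have n0 : (n%:C)%C != 0.
  by rewrite eq_complex/= eqxx andbT lt0r_neq0 ?(vecs_nsq_gt0 PF).
have diag : F al * conjc (F al) * (m%:C)%C = G al * conjc (G al) * (n%:C)%C.
  have := crd al; rewrite /sqm; case: (F al) (G al) => [a b] [c d]/= h.
  by apply/eqP; rewrite eq_complex/=; apply/andP; split; apply/eqP; lra.
apply: (@vecs_inj _ _ _ _ G) => //.
have -> : G = (G al / F al) *: F.
  apply/funext => be; rewrite -[RHS]/(G al / F al * F be).
  have [->|ba] := eqVneq be al; first by rewrite divfK.
  have h := prod al be; rewrite eq_sym in h; move/(_ ba): h => h.
  apply: (mulIf Fal); rewrite mulrAC divfK//.
  have c0 : conjc (G al) * (n%:C)%C != 0 by rewrite mulf_neq0// conjc_eq0.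
  apply: (mulIf c0).
  transitivity (F al * (G be * conjc (G al) * (n%:C)%C)); first by ring.
  rewrite -h; transitivity (F be * (F al * conjc (F al) * (m%:C)%C)); first by ring.
  by rewrite diag; ring.
by apply: vecsZ; rewrite ?mulf_neq0 ?invr_neq0.
Qed.

End Isometry.

(** * The automorphism group *)

Section Identity.
Context (R : realType) (K : fieldType).
Implicit Types (F G : coefs R K) (al be : K) (P Q : PH R K).

(** The line of an absolutely summable family with nonzero sum is a point of
    N[K], so its image cannot be spanned by a family of sum zero. *)
Lemma line_not_null (V : PH R K -> PH R K) (U : PN R K -> PN R K) :
  (forall p : PN R K, PN_PH (U p) = V (PN_PH p)) ->
  forall P F, vecs P F -> csummable setT F -> csum setT F != 0 ->
  forall G, vecs (V P) G -> ~ null_sum G.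
Proof.
move=> UV P F PF sF F0.
have PP : PN_points P.
  move=> G PG [_ G0]; have [c c0 e] := vecs_colinear PF PG.
  move: G0; rewrite e -[X in csum _ X]/(fun t => c * F t) csumZ//.
  by apply/eqP; rewrite mulf_neq0.
pose p : PN R K := SigSub (mem_set PP).
by move=> G PG; have := set_valP (U p); rewrite -/(PN_PH (U p)) UV; exact.
Qed.

Lemma isometry_fix_minus (V : PH R K -> PH R K) (U : PN R K -> PN R K) :
  bijective V -> (forall P Q, fs_dist (V P) (V Q) = fs_dist P Q) ->
  (forall al, V (mono_PH R al) = mono_PH R al) ->
  (forall p : PN R K, PN_PH (U p) = V (PN_PH p)) ->
  forall P al be, al != be -> vecs P (pairv al be 1 (-1)) -> V P = P.
Proof.
move=> [W WK VK] Vd Vm UV P al be ab PF.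
pose Q := W P; have VQ : V Q = P by rewrite /Q VK.
have QG := vecs_rep Q; set G := rep Q in QG.
have PF' : vecs (V Q) (pairv al be 1 (-1)) by rewrite VQ.
have eG : G = pairv al be (G al) (G be).
  apply: eq_pairv => // t ta tb; apply/eqP.
  by rewrite -(isometry_coord0 Vd Vm t QG PF') pairv_out.
have nul : G al + G be = 0.
  apply: contrapT => /eqP ne.
  have sG : csummable setT G by rewrite eG; exact: csummable_pairv.
  have cG : csum setT G != 0 by rewrite eG csum_pairv.
  apply: (line_not_null UV QG sG cG PF').
  by split; [exact: csummable_pairv|rewrite csum_pairv subrr].
suff QF : vecs Q (pairv al be 1 (-1)) by rewrite -{1}(vecs_inj QF PF).
have a0 : G al != 0.
  by rewrite -(isometry_coord0 Vd Vm al QG PF') pairvl ?oner_eq0.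
have -> : pairv al be 1 (-1) = (G al)^-1 *: G.
  have eb : G be = - G al by apply/eqP; rewrite -addr_eq0 addrC nul.
  by rewrite [X in _ *: X]eG eb /pairv scalerDr !scalerA mulVf// mulrN mulVf.
by apply: vecsZ; rewrite ?invr_neq0.
Qed.

(** The partial operations are single-valued. *)
Lemma PN_mul_functional (op : K -> K -> K) (P Q S S' : PN R K) :
  PN_mul op P Q S -> PN_mul op P Q S' -> S = S'.
Proof.
move=> [F [G [PF QG [FG _] SFG]]] [F' [G' [PF' QG' _ SFG']]].
have [c c0 eF] := vecs_colinear PF PF'; have [d d0 eG] := vecs_colinear QG QG'.
have e : convolution op F' G' = (c * d) *: convolution op F G.
  apply/funext => al; rewrite /convolution.
  rewrite -[RHS]/((c * d) * csum _ _) -csumZ; last exact: FG.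
  congr csum; apply/funext => p; rewrite eF eG.
  by rewrite -[LHS]/((c * F p.1) * (d * G p.2)); ring.
apply: val_inj; apply: esym; apply: (vecs_inj SFG').
by rewrite e; apply: vecsZ => //; rewrite mulf_neq0.
Qed.

Lemma holomorphic_id : holomorphic (idfun : PH R K -> PH R K).
Proof.
move=> F G F2 F0 G2; exists (fun z => F + z *: G), G; split => //.
  by near=> z => P.
(* The difference quotient equals G exactly for z != 0. *)
apply: cvg_near_cst; near=> z.
have z0 : z != 0 by near: z; exact: nbhs_dnbhs_neq.
rewrite scale0r addr0 addrAC subrr add0r scalerA mulVf// scale1r subrr.
rewrite hnormE /nsq esum1 ?sqrtr0// => t _.
by rewrite -[X in sqm X]/(0 : R[i]) sqm0.
Unshelve. all: by end_near.
Qed.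

Lemma nonlinear_automorphism_id (M : set {rmorphism K -> R[i]}) :
  nonlinear_automorphism M (idfun : PN R K -> PN R K).
Proof.
split; last by split=> P Q S S'; exact: PN_mul_functional.
exists idfun; split => //.
- by split; [exists idfun| |exact: holomorphic_id].
- by exists idfun; split; [exists idfun|move=> theta; rewrite image_id].
Qed.

End Identity.

Theorem theorem8 (R : realType) (K : fieldType) (iota : {rmorphism rat -> K})
    (M : set {rmorphism K -> R[i]}) :
  galois_over_Q iota -> conj_representatives M ->
  nonlinear_Gal M = [set idfun].
Proof.
move=> _ _; apply/seteqP; split => U /=; last first.
  by move=> ->; split; [exact: nonlinear_automorphism_id|].
move=> [[[V [[Vbij Vd Vholo] _ UV]] _] Ufix].
have Vm al : V (mono_PH R al) = mono_PH R al.
  by rewrite -[mono_PH R al]/(PN_PH (mono_PN R al)) -UV Ufix.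
have Vminus := isometry_fix_minus Vbij Vd Vm UV.
apply/funext => P; apply: val_inj.
by rewrite -/(PN_PH (U P)) UV (isometry_fix Vd Vm Vminus Vholo).
Qed.
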